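(* Let $\psi\in L^2_{\mathrm{loc}}(\mathbb{R})$. The following are equivalent: (i) $K_\psi$ is bounded on $L^2(\mathbb{R})$; (ii) $K^+_\psi$ is bounded on $L^2(\mathbb{R})$; (iii) $\displaystyle\sup_{n\in\mathbb{Z}}\int_n^{n+1}|\psi(x)|^2dx<\infty$.
   Context: For $\psi\in L^2_{\mathrm{loc}}(\mathbb{R})$, $K_\psi$ is the integral operator with kernel $\psi(\max\{s,t\})e^{-|s-t|}$, and $K_\psi^+$ is its triangular part, i.e. the integral operator whose kernel is $\psi(\max\{s,t\})e^{-|s-t|}=\psi(s)e^{-(s-t)}$ for $t<s$ and $0$ otherwise: $$(K_\psi f)(s)=\int_{\mathbb{R}}\psi(\max\{s,t\})e^{-|s-t|}f(t)\,dt,\qquad (K_\psi^+f)(s)=\int_{-\infty}^s\psi(s)e^{-(s-t)}f(t)\,dt,$$ defined initially on bounded compactly supported functions $f$ on $\mathbb{R}$. Such an operator is bounded on $L^2(\mathbb{R})$ if it extends to a bounded operator on $L^2(\mathbb{R})$. *)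

(* Defs.v *)
From mathcomp Require Export all_boot all_order all_algebra.
From mathcomp Require Export all_classical all_reals all_analysis.
From mathcomp Require Export complex.

Set Implicit Arguments.
Unset Strict Implicit.
Unset Printing Implicit Defensive.

Import Order.TTheory GRing.Theory Num.Theory.
Import numFieldNormedType.Exports.

Local Open Scope classical_set_scope.
Local Open Scope ring_scope.
Local Open Scope complex_scope.

(* Functions are complex-valued representatives, Borel measurable on the real
   line.  MathComp-Analysis has neither a measurable structure on R[i] nor
   complex-valued integrals: both are taken componentwise. *)
Definition cmeasurable (R : realType) (f : R -> R[i]) : Prop :=
  measurable_fun setT (fun x => complex.Re (f x)) /\
  measurable_fun setT (fun x => complex.Im (f x)).

Definition cintegral (R : realType) (D : set R) (f : R -> R[i]) : R[i] :=
  Rintegral lebesgue_measure D (fun x => complex.Re (f x)) +i*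
  Rintegral lebesgue_measure D (fun x => complex.Im (f x)).

(* The real-valued modulus; `|z| in R[i] is itself an element of R[i]. *)
Definition cmod (R : realType) (z : R[i]) : R := ComplexField.Normc.normc z.

Definition L2norm (R : realType) (f : R -> R[i]) : \bar R :=
  Lnorm lebesgue_measure 2%:E (fun x => (cmod (f x))%:E).

Definition L2 (R : realType) (f : R -> R[i]) : Prop :=
  cmeasurable f /\ (L2norm f < +oo)%E.

Definition L2loc (R : realType) (f : R -> R[i]) : Prop :=
  cmeasurable f /\ locally_integrable setT (fun x => cmod (f x) ^+ 2).

Definition bounded_compactly_supported (R : realType) (f : R -> R[i]) : Prop :=
  [/\ cmeasurable f,
      exists M : R, forall x, cmod (f x) <= M &
      compact (closure [set x | f x != 0])].

(* A bounded linear operator on the Hilbert space L^2(R), presented through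
   its action on representatives; identities hold almost everywhere. *)
Definition L2_bounded_operator (R : realType)
    (T : (R -> R[i]) -> (R -> R[i])) : Prop :=
  [/\ forall f, L2 f -> L2 (T f),
      forall f g, L2 f -> L2 g ->
        f = g %[ae lebesgue_measure] -> T f = T g %[ae lebesgue_measure],
      forall (a : R[i]) f g, L2 f -> L2 g ->
        T (fun x => a * f x + g x) = (fun x => a * T f x + T g x)
          %[ae lebesgue_measure] &
      exists C : R, forall f, L2 f -> (L2norm (T f) <= C%:E * L2norm f)%E].

(* K, which is only meant on bounded compactly supported functions, extends
   to a bounded operator on L^2(R). *)
Definition bounded_on_L2 (R : realType)
    (K : (R -> R[i]) -> (R -> R[i])) : Prop :=
  exists T : (R -> R[i]) -> (R -> R[i]), L2_bounded_operator T /\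
    forall f, bounded_compactly_supported f ->
      T f = K f %[ae lebesgue_measure].

Definition Kop (R : realType) (psi f : R -> R[i]) (s : R) : R[i] :=
  cintegral setT
    (fun t => psi (Num.max s t) * (expR (- `|s - t|))%:C * f t).

Definition Kop_plus (R : realType) (psi f : R -> R[i]) (s : R) : R[i] :=
  cintegral `]-oo, s[
    (fun t => psi s * (expR (- (s - t)))%:C * f t).

(* Main.v *)
Require Import Defs.
From mathcomp Require Import lra measurable_realfun.

(** The uniform local square integrability of psi is sufficient by a Schur
    test.  Put w = 1 + |psi|^2.  The kernels of both operators are dominated by
    |psi (max s t)| exp(-|s - t|), whose square is at most p(s, t) q(s, t) with
    p(s, t) = exp(-|s - t|) w(t) and q(s, t) = exp(-|s - t|) w(s)
    ([exp_dominated_schur]).  By Cauchy-Schwarz ([cauchy_schwarz_weighted]) and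
    Tonelli, an integral operator whose kernel is dominated by sqrt (p q) is
    bounded on L2 as soon as the integrals of p over t and of q over s are
    uniformly bounded ([schur_test]).  Here the two integrals are the same
    exponential average of w, and it is bounded because w has bounded integral
    over unit intervals: far cells are damped geometrically
    ([exp_weight_bound]).

    The condition is necessary because it can be read off from the images of
    indicators.  If f is the indicator of [a - 1, a] and a < s < a + 1, then
    only the part t < s of the kernel is seen, so both operators send f to
    psi(s) times the integral of e^-(s - t) over [a - 1, a], which is at least
    e^-2 |psi(s)| in modulus ([kernel_op_unit_indic_ge]).  As f has norm 1, the
    integral of |psi|^2 over [a, a + 1] is bounded by e^4 times the square of
    the operator norm ([unit_integral_le_of_bounded]). *)

Import Order.TTheory GRing.Theory Num.Theory.
Import numFieldNormedType.Exports.
Set Implicit Arguments.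
Unset Strict Implicit.
Unset Printing Implicit Defensive.

Local Open Scope classical_set_scope.
Local Open Scope ring_scope.

(** * The modulus of complex-valued functions *)

Lemma cmod_ge0 (R : realType) (z : R[i]) : 0 <= cmod z.
Proof. by case: z => a b; rewrite /cmod /= sqrtr_ge0. Qed.

Lemma cmodM (R : realType) (y z : R[i]) : cmod (y * z) = cmod y * cmod z.
Proof. exact: ComplexField.Normc.normcM. Qed.

Lemma cmod_real (R : realType) (x : R) : cmod (x%:C)%C = `|x|.
Proof. by rewrite /cmod /= expr0n addr0 sqrtr_sqr. Qed.

Lemma sqr_cmod (R : realType) (z : R[i]) :
  cmod z ^+ 2 = complex.Re z ^+ 2 + complex.Im z ^+ 2.
Proof. by case: z => a b; rewrite /cmod /= sqr_sqrtr// addr_ge0// sqr_ge0. Qed.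

Lemma normr_Re_le_cmod (R : realType) (z : R[i]) : `|complex.Re z| <= cmod z.
Proof.
rewrite -(@ler_pXn2r _ 2)// ?nnegrE ?cmod_ge0// sqr_cmod real_normK ?num_real//.
by rewrite lerDl sqr_ge0.
Qed.

Lemma normr_Im_le_cmod (R : realType) (z : R[i]) : `|complex.Im z| <= cmod z.
Proof.
rewrite -(@ler_pXn2r _ 2)// ?nnegrE ?cmod_ge0// sqr_cmod real_normK ?num_real//.
by rewrite lerDr sqr_ge0.
Qed.

Lemma measurable_cmod d (T : measurableType d) (R : realType) (f : T -> R[i]) :
  measurable_fun setT (fun x => complex.Re (f x)) ->
  measurable_fun setT (fun x => complex.Im (f x)) ->
  measurable_fun setT (fun x => cmod (f x)).
Proof.
move=> mr mi.
have -> : (fun x => cmod (f x)) = (fun x =>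
    (complex.Re (f x) ^+ 2 + complex.Im (f x) ^+ 2) `^ 2^-1).
  apply/funext => x; rewrite -sqr_cmod powR12_sqrt ?sqr_ge0//.
  by rewrite sqrtr_sqr ger0_norm// cmod_ge0.
apply: (measurableT_comp (measurable_powR _)).
by apply: measurable_funD; exact: measurable_funX.
Qed.

Lemma sqr_Lnorm2 d (T : measurableType d) (R : realType)
    (mu : {measure set T -> \bar R}) (f : T -> R) :
  ('N[mu]_2%:E[EFin \o f] ^+ 2 = \int[mu]_t (f t ^+ 2)%:E)%E.
Proof.
rewrite unlock poweR12_sqrt; last first.
  by apply: integral_ge0 => t _; exact: poweR_ge0.
rewrite sqr_sqrte; last by apply: integral_ge0 => t _; exact: poweR_ge0.
apply: eq_integral => t _ /=.
by rewrite powR_mulrn// real_normK ?num_real.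
Qed.

(** * The Cauchy-Schwarz inequality, with weights *)

(** Cauchy-Schwarz in the form that splits a kernel: h is bounded by the
    geometric mean of p and q, and only the integrals of p and q appear.  In
    extended reals the inequality also covers divergent integrals. *)
Lemma cauchy_schwarz_weighted d (T : measurableType d) (R : realType)
    (mu : {measure set T -> \bar R}) (h p q : T -> R) :
  measurable_fun setT h -> measurable_fun setT p -> measurable_fun setT q ->
  (forall t, 0 <= h t) -> (forall t, 0 <= p t) -> (forall t, 0 <= q t) ->
  (forall t, h t ^+ 2 <= p t * q t) ->
  ((\int[mu]_t (h t)%:E) ^+ 2 <= \int[mu]_t (p t)%:E * \int[mu]_t (q t)%:E)%E.
Proof.
move=> mh mp mq h0 p0 q0 hpq.
pose sq (g : T -> R) t := g t `^ 2^-1.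
have msq (g : T -> R) : measurable_fun setT g -> measurable_fun setT (sq g).
  by move=> mg; exact: (measurableT_comp (measurable_powR _)).
have sqK (g : T -> R) : (forall t, 0 <= g t) -> forall t, sq g t ^+ 2 = g t.
  by move=> g0 t; rewrite /sq powR12_sqrt// sqr_sqrtr.
have norm2 (g : T -> R) : (forall t, 0 <= g t) ->
    ('N[mu]_2%:E[EFin \o sq g] ^+ 2 = \int[mu]_t (g t)%:E)%E.
  by move=> g0; rewrite sqr_Lnorm2; apply: eq_integral => t _; rewrite sqK.
(* Hoelder's inequality is used for sqrt p and sqrt q, with exponents 2 and 2. *)
have half : 2^-1 + 2^-1 = 1 :> R by rewrite [RHS]splitr div1r.
have := hoelder mu (msq _ mp) (msq _ mq) (ltr0Sn _ _) (ltr0Sn _ _) half.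
rewrite Lnorm1 => CS.
rewrite -(norm2 p)// -(norm2 q)// !expe2 muleACA -!expe2.
rewrite lee_sqr; [|by apply: integral_ge0 => t _; rewrite lee_fin
                  |by rewrite mule_ge0// Lnorm_ge0].
apply: le_trans CS; apply: ge0_le_integral => //.
- by move=> t _; rewrite lee_fin.
- exact/measurable_EFinP.
- apply: measurableT_comp => //; apply/measurable_EFinP.
  by apply: measurable_funM; exact: msq.
- move=> t _; rewrite /= lee_fin ger0_norm ?mulr_ge0 ?powR_ge0//.
  rewrite -(@ler_pXn2r _ 2)// ?nnegrE ?mulr_ge0 ?powR_ge0//.
  by rewrite exprMn !sqK.
Qed.

(** * Measurability and integrals of complex-valued functions *)

(** At T = R this unfolds to [cmeasurable]; kernels need it on R * R. *)
Definition measurable_ReIm d (T : measurableType d) (R : realType)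
    (F : T -> R[i]) : Prop :=
  measurable_fun setT (fun x => complex.Re (F x)) /\
  measurable_fun setT (fun x => complex.Im (F x)).

Lemma measurable_ReImM d (T : measurableType d) (R : realType)
    (F G : T -> R[i]) :
  measurable_ReIm F -> measurable_ReIm G ->
  measurable_ReIm (fun x => F x * G x).
Proof.
move=> [Fr Fi] [Gr Gi]; split.
- have -> : (fun x => complex.Re (F x * G x)) = (fun x =>
      complex.Re (F x) * complex.Re (G x) - complex.Im (F x) * complex.Im (G x)).
    by apply/funext => x; case: (F x) => a b; case: (G x).
  by apply: measurable_funB; exact: measurable_funM.
- have -> : (fun x => complex.Im (F x * G x)) = (fun x =>
      complex.Re (F x) * complex.Im (G x) + complex.Im (F x) * complex.Re (G x)).
    by apply/funext => x; case: (F x) => a b; case: (G x).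
  by apply: measurable_funD; exact: measurable_funM.
Qed.

Lemma measurable_ReIm_comp d (T : measurableType d) d' (T' : measurableType d')
    (R : realType) (F : T -> R[i]) (h : T' -> T) :
  measurable_ReIm F -> measurable_fun setT h ->
  measurable_ReIm (fun x => F (h x)).
Proof.
by move=> [mr mi] mh; split; [exact: (measurableT_comp mr)|
                              exact: (measurableT_comp mi)].
Qed.

(** An integral that is not finite has [Rintegral] equal to 0, so the
    inequality holds there too.  The norm estimate for an integral operator
    can thus be made without discussing where the operator converges. *)
Lemma normr_Rintegral_le d (T : measurableType d) (R : realType)
    (mu : {measure set T -> \bar R}) (g : T -> R) : measurable_fun setT g ->
  (`|Rintegral mu setT g|%:E <= \int[mu]_t `|g t|%:E)%E.
Proof.
move=> mg; apply: (@le_trans _ _ `|\int[mu]_t (g t)%:E|%E).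
  by rewrite /Rintegral; case: (integral _ _ _) => //=; rewrite normr0 leey.
by apply: le_abse_integral => //; exact/measurable_EFinP.
Qed.

Lemma sqr_cmod_cintegral_le (R : realType) (F : R -> R[i]) : cmeasurable F ->
  ((cmod (cintegral setT F) ^+ 2)%:E <=
   2%:E * (\int[lebesgue_measure]_t (cmod (F t))%:E) ^+ 2)%E.
Proof.
move=> mF; rewrite sqr_cmod /cintegral.
have bound (g : R -> R) : measurable_fun setT g ->
    (forall t, `|g t| <= cmod (F t)) ->
    (((Rintegral lebesgue_measure setT g) ^+ 2)%:E <=
     (\int[lebesgue_measure]_t (cmod (F t))%:E) ^+ 2)%E.
  move=> mg gF; rewrite -[X in X%:E]real_normK ?num_real// EFin_expe.
  rewrite lee_sqr//; last by apply: integral_ge0 => t _; rewrite lee_fin cmod_ge0.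
  apply: le_trans (normr_Rintegral_le lebesgue_measure mg) _.
  apply: ge0_le_integral => //.
  - by apply/measurable_EFinP; exact: measurableT_comp.
  - by apply/measurable_EFinP; apply: measurable_cmod; case: mF.
  - by move=> t _; rewrite lee_fin.
rewrite mule_natl mule2n.
rewrite /= EFinD; case: mF => mr mi; apply: leeD; apply: bound => // t.
- exact: normr_Re_le_cmod.
- exact: normr_Im_le_cmod.
Qed.

(** The integral is by definition the difference of the integrals of the
    positive and negative parts, to which Tonelli's theorem applies; so the
    section integral is measurable even where a section is not integrable. *)
Lemma measurable_Rintegral_section d d' (S : measurableType d)
    (T : measurableType d') (R : realType)
    (mu : {sigma_finite_measure set T -> \bar R}) (g : S * T -> R) :
  measurable_fun setT g ->
  measurable_fun setT (fun s => Rintegral mu setT (fun t => g (s, t))).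
Proof.
move=> mg; apply: (measurableT_comp (fine_measurable _)) => //.
have mg' : measurable_fun setT (EFin \o g) by exact/measurable_EFinP.
under eq_fun do rewrite integralE.
apply: emeasurable_funB.
- rewrite (_ : (fun s => _) = fubini_F mu (EFin \o g)^\+%E).
    apply: measurable_fun_fubini_tonelli_F => //; exact: measurable_funepos.
  by apply/funext => s; apply: eq_integral => t _; rewrite !funeposE.
- rewrite (_ : (fun s => _) = fubini_F mu (EFin \o g)^\-%E).
    apply: measurable_fun_fubini_tonelli_F => //; exact: measurable_funeneg.
  by apply/funext => s; apply: eq_integral => t _; rewrite !funenegE.
Qed.

(** * The Schur test *)

Lemma sqr_L2norm (R : realType) (f : R -> R[i]) :
  (L2norm f ^+ 2 = \int[lebesgue_measure]_t (cmod (f t) ^+ 2)%:E)%E.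
Proof. exact: sqr_Lnorm2. Qed.

Lemma L2norm_lty (R : realType) (f : R -> R[i]) :
  (L2norm f < +oo)%E ->
  (\int[lebesgue_measure]_t (cmod (f t) ^+ 2)%:E < +oo)%E.
Proof.
move=> f2; rewrite -sqr_L2norm expe2.
have : L2norm f \is a fin_num by rewrite ge0_fin_numE// Lnorm_ge0.
by case: (L2norm f) => // r _; rewrite -EFinM ltry.
Qed.

Lemma lty_L2norm (R : realType) (f : R -> R[i]) :
  (\int[lebesgue_measure]_t (cmod (f t) ^+ 2)%:E < +oo)%E ->
  (L2norm f < +oo)%E.
Proof.
rewrite -sqr_L2norm; case: (L2norm f) => [r _| |]//; by rewrite ltry.
Qed.

Lemma cintegral_linear (R : realType) (a : R[i]) (F G : R -> R[i]) :
  cmeasurable F -> cmeasurable G ->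
  (\int[lebesgue_measure]_t (cmod (F t))%:E < +oo)%E ->
  (\int[lebesgue_measure]_t (cmod (G t))%:E < +oo)%E ->
  cintegral setT (fun t => a * F t + G t) =
  a * cintegral setT F + cintegral setT G.
Proof.
have integ (H : R -> R[i]) (h : R -> R) : cmeasurable H ->
    (\int[lebesgue_measure]_t (cmod (H t))%:E < +oo)%E ->
    measurable_fun setT h -> (forall t, `|h t| <= cmod (H t)) ->
    (@lebesgue_measure R).-integrable setT (EFin \o h).
  move=> [mHr mHi] Hoo mh hH; apply/integrableP; split.
    exact/measurable_EFinP.
  apply: le_lt_trans Hoo; apply: ge0_le_integral => //.
  - by apply: measurableT_comp => //; exact/measurable_EFinP.
  - by apply/measurable_EFinP; exact: measurable_cmod.
  - by move=> t _; rewrite lee_fin.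
move=> mF mG Foo Goo; have [mFr mFi] := mF; have [mGr mGi] := mG.
have iFr := integ F _ mF Foo mFr (fun t => normr_Re_le_cmod (F t)).
have iFi := integ F _ mF Foo mFi (fun t => normr_Im_le_cmod (F t)).
have iGr := integ G _ mG Goo mGr (fun t => normr_Re_le_cmod (G t)).
have iGi := integ G _ mG Goo mGi (fun t => normr_Im_le_cmod (G t)).
have iZ (c : R) (h : R -> R) :
    (@lebesgue_measure R).-integrable setT (EFin \o h) ->
    (@lebesgue_measure R).-integrable setT (EFin \o (fun t => c * h t)).
  by move=> ih; apply: (integrableZl _ c ih).
have comb (c1 c2 : R) (h1 h2 h3 : R -> R) :
    (@lebesgue_measure R).-integrable setT (EFin \o h1) ->
    (@lebesgue_measure R).-integrable setT (EFin \o h2) ->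
    (@lebesgue_measure R).-integrable setT (EFin \o h3) ->
    Rintegral lebesgue_measure setT (fun t => c1 * h1 t + c2 * h2 t + h3 t) =
    c1 * Rintegral lebesgue_measure setT h1 +
    c2 * Rintegral lebesgue_measure setT h2 +
    Rintegral lebesgue_measure setT h3.
  move=> i1 i2 i3; have iz1 := iZ c1 _ i1; have iz2 := iZ c2 _ i2.
  have i12 : (@lebesgue_measure R).-integrable setT
      (EFin \o (fun t => c1 * h1 t + c2 * h2 t)).
    exact: (integrableD _ iz1 iz2).
  by rewrite (RintegralD _ i12 i3)// (RintegralD _ iz1 iz2)// !RintegralZl.
rewrite /cintegral; case: a => a b.
have -> : (fun t => complex.Re ((a +i* b)%C * F t + G t)) = (fun t =>
    a * complex.Re (F t) + (- b) * complex.Im (F t) + complex.Re (G t)).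
  by apply/funext => t; case: (F t) => ? ?; case: (G t) => ? ? /=; rewrite mulNr.
have -> : (fun t => complex.Im ((a +i* b)%C * F t + G t)) = (fun t =>
    a * complex.Im (F t) + b * complex.Re (F t) + complex.Im (G t)).
  by apply/funext => t; case: (F t) => ? ?; case: (G t).
by rewrite !comb//= mulNr.
Qed.

Definition kernel_op (R : realType) (k : R -> R -> R[i]) (f : R -> R[i])
    (s : R) : R[i] :=
  cintegral setT (fun t => k s t * f t).

(** The hypotheses of the Schur test: the kernel is dominated by sqrt (p q),
    where p has integrals over t at most A, uniformly in s, and q has integrals
    over s at most B, uniformly in t. *)
Record schur_kernel (R : realType) (k : R -> R -> R[i]) (p q : R -> R -> R)
    (A B : R) : Prop := SchurKernel {
  schur_measurable : measurable_ReIm (fun z : R * R => k z.1 z.2) ;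
  schur_measurable_p : measurable_fun setT (fun z : R * R => p z.1 z.2) ;
  schur_measurable_q : measurable_fun setT (fun z : R * R => q z.1 z.2) ;
  schur_p_ge0 : forall s t, 0 <= p s t ;
  schur_q_ge0 : forall s t, 0 <= q s t ;
  schur_dominated : forall s t, cmod (k s t) ^+ 2 <= p s t * q s t ;
  schur_int_p :
    forall s, (\int[lebesgue_measure]_t (p s t)%:E <= A%:E)%E ;
  schur_int_q :
    forall t, (\int[lebesgue_measure]_s (q s t)%:E <= B%:E)%E }.

Lemma measurable_ReIm_kernel (R : realType) (k : R -> R -> R[i])
    (f : R -> R[i]) :
  measurable_ReIm (fun z : R * R => k z.1 z.2) -> cmeasurable f ->
  measurable_ReIm (fun z : R * R => k z.1 z.2 * f z.2).
Proof.
move=> mk mf; apply: measurable_ReImM => //.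
by apply: (measurable_ReIm_comp mf); exact: measurable_snd.
Qed.

Lemma cmeasurable_kernel_section (R : realType) (k : R -> R -> R[i])
    (f : R -> R[i]) (s : R) :
  measurable_ReIm (fun z : R * R => k z.1 z.2) -> cmeasurable f ->
  cmeasurable (fun t => k s t * f t).
Proof.
move=> mk mf; have := measurable_ReIm_kernel mk mf.
move=> /(@measurable_ReIm_comp _ _ _ _ _ _ (pair s)); apply.
exact: pair1_measurable.
Qed.

Lemma cmeasurable_kernel_op (R : realType) (k : R -> R -> R[i])
    (f : R -> R[i]) :
  measurable_ReIm (fun z : R * R => k z.1 z.2) -> cmeasurable f ->
  cmeasurable (kernel_op k f).
Proof.
move=> mk mf; have [mr mi] := measurable_ReIm_kernel mk mf.
by split; [exact: (measurable_Rintegral_section lebesgue_measure mr)|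
           exact: (measurable_Rintegral_section lebesgue_measure mi)].
Qed.

(** Cauchy-Schwarz for k f, dominated by the square root of p times q |f|^2;
    the factor p is integrated out. *)
Lemma schur_integral_section (R : realType) (k : R -> R -> R[i])
    (p q : R -> R -> R) (A B : R) (f : R -> R[i]) (s : R) :
  schur_kernel k p q A B -> cmeasurable f ->
  ((\int[lebesgue_measure]_t (cmod (k s t * f t))%:E) ^+ 2 <=
   A%:E * \int[lebesgue_measure]_t (q s t * cmod (f t) ^+ 2)%:E)%E.
Proof.
move=> [mk mp mq p0 q0 dom intp intq] mf.
have [mr mi] := cmeasurable_kernel_section s mk mf.
have msec (g : R -> R -> R) : measurable_fun setT (fun z : R * R => g z.1 z.2) ->
    measurable_fun setT (g s).
  by move=> mg; exact: (measurableT_comp mg (pair1_measurable s)).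
have mf2 : measurable_fun setT (fun t => cmod (f t) ^+ 2).
  by apply: measurable_funX; apply: measurable_cmod; case: mf.
have mh : measurable_fun setT (fun t => cmod (k s t * f t)).
  exact: measurable_cmod.
have mqf : measurable_fun setT (fun t => q s t * cmod (f t) ^+ 2).
  by apply: measurable_funM => //; exact: msec.
have h0 t : 0 <= cmod (k s t * f t) by exact: cmod_ge0.
have qf0 t : 0 <= q s t * cmod (f t) ^+ 2 by rewrite mulr_ge0// sqr_ge0.
have hle t : cmod (k s t * f t) ^+ 2 <= p s t * (q s t * cmod (f t) ^+ 2).
  by rewrite cmodM exprMn mulrA ler_wpM2r// sqr_ge0.
apply: le_trans (cauchy_schwarz_weighted lebesgue_measure
  mh (msec _ mp) mqf h0 (p0 s) qf0 hle) _.
apply: lee_wpmul2r; last exact: intp.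
by apply: integral_ge0 => t _; rewrite lee_fin.
Qed.

(** After the exchange of integrals (Tonelli), the inner one only sees q. *)
Lemma schur_integral_total (R : realType) (k : R -> R -> R[i])
    (p q : R -> R -> R) (A B : R) (f : R -> R[i]) :
  schur_kernel k p q A B -> cmeasurable f ->
  (\int[lebesgue_measure]_s \int[lebesgue_measure]_t
      (q s t * cmod (f t) ^+ 2)%:E <=
   B%:E * \int[lebesgue_measure]_t (cmod (f t) ^+ 2)%:E)%E.
Proof.
move=> [mk mp mq p0 q0 dom intp intq] mf.
have mf2 : measurable_fun setT (fun t => cmod (f t) ^+ 2).
  by apply: measurable_funX; apply: measurable_cmod; case: mf.
have B0 : 0 <= B.
  rewrite -lee_fin; apply: le_trans (intq 0); apply: integral_ge0 => s _.
  by rewrite lee_fin.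
have mqf : measurable_fun setT
    (fun z : R * R => (q z.1 z.2 * cmod (f z.2) ^+ 2)%:E).
  apply/measurable_EFinP; apply: measurable_funM => //.
  by apply: (measurableT_comp mf2); exact: measurable_snd.
have qf0 (z : R * R) : (0 <= (q z.1 z.2 * cmod (f z.2) ^+ 2)%:E)%E.
  by rewrite lee_fin mulr_ge0// sqr_ge0.
rewrite (_ : (\int[_]_s \int[_]_t _ = \int[lebesgue_measure]_t
    \int[lebesgue_measure]_s (q s t * cmod (f t) ^+ 2)%:E)%E); last first.
  exact: (fubini_tonelli (m1 := lebesgue_measure) (m2 := lebesgue_measure)
    _ mqf qf0).
rewrite -ge0_integralZl//; [|exact/measurable_EFinP|
  by move=> t _; rewrite lee_fin sqr_ge0].
apply: ge0_le_integral => //.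
- move=> t _; apply: integral_ge0 => s _.
  by rewrite lee_fin mulr_ge0// sqr_ge0.
- exact: (measurable_fun_fubini_tonelli_G (m1 := lebesgue_measure) _ mqf qf0).
- by apply: measurable_funeM; exact/measurable_EFinP.
- move=> t _; under eq_integral do rewrite EFinM.
  rewrite ge0_integralZr//; first by apply: lee_wpmul2r => //;
    rewrite lee_fin sqr_ge0.
  + apply/measurable_EFinP.
    exact: (measurableT_comp mq (pair2_measurable t)).
  + by move=> s _; rewrite lee_fin.
  + by rewrite lee_fin sqr_ge0.
Qed.

(** The statements about operators on L2 speak of the Lebesgue measure on the
    sigma-algebra generated by half-open intervals; under this presentation
    instance search needs the filter property of the co-null sets restated. *)
Lemma ae_lebesgue_filter (R : realType) :
  Filter (almost_everywhere (@lebesgue_measure R)).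
Proof. exact: (ae_filter_ringOfSetsType (@lebesgue_measure R)). Qed.

#[local] Hint Extern 0 (Filter (almost_everywhere lebesgue_measure)) =>
  (apply: ae_lebesgue_filter) : typeclass_instances.
#[local] Hint Extern 0 (Filter (nbhs (almost_everywhere lebesgue_measure))) =>
  (apply: ae_lebesgue_filter) : typeclass_instances.

Lemma schur_constants_ge0 (R : realType) (k : R -> R -> R[i])
    (p q : R -> R -> R) (A B : R) :
  schur_kernel k p q A B -> 0 <= A /\ 0 <= B.
Proof.
move=> [_ _ _ p0 q0 _ intp intq]; split; rewrite -lee_fin.
- by apply: le_trans (intp 0); apply: integral_ge0 => t _; rewrite lee_fin.
- by apply: le_trans (intq 0); apply: integral_ge0 => s _; rewrite lee_fin.
Qed.

Lemma measurable_schur_integral (R : realType) (k : R -> R -> R[i])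
    (p q : R -> R -> R) (A B : R) (f : R -> R[i]) :
  schur_kernel k p q A B -> cmeasurable f ->
  measurable_fun setT (fun s =>
    \int[lebesgue_measure]_t (q s t * cmod (f t) ^+ 2)%:E)%E.
Proof.
move=> [mk mp mq p0 q0 dom intp intq] [mfr mfi].
have mqf : measurable_fun setT
    (fun z : R * R => (q z.1 z.2 * cmod (f z.2) ^+ 2)%:E).
  apply/measurable_EFinP; apply: measurable_funM => //.
  apply: measurable_funX; apply: measurable_cmod.
  - by apply: (measurableT_comp mfr); exact: measurable_snd.
  - by apply: (measurableT_comp mfi); exact: measurable_snd.
apply: (measurable_fun_fubini_tonelli_F (m2 := lebesgue_measure) _ mqf).
by move=> z; rewrite lee_fin mulr_ge0// sqr_ge0.
Qed.

(** The constant 2 comes from bounding the real and the imaginary part of the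
    integral separately by the integral of the modulus. *)
Lemma schur_sqr_norm (R : realType) (k : R -> R -> R[i])
    (p q : R -> R -> R) (A B : R) (f : R -> R[i]) :
  schur_kernel k p q A B -> cmeasurable f ->
  (\int[lebesgue_measure]_s (cmod (kernel_op k f s) ^+ 2)%:E <=
   (2 * A * B)%:E * \int[lebesgue_measure]_t (cmod (f t) ^+ 2)%:E)%E.
Proof.
move=> K mf; have [A0 B0] := schur_constants_ge0 K.
have [mTr mTi] := cmeasurable_kernel_op (schur_measurable K) mf.
have mQ := measurable_schur_integral K mf.
have Q0 s :
    (0 <= \int[lebesgue_measure]_t (q s t * cmod (f t) ^+ 2)%:E)%E.
  apply: integral_ge0 => t _.
  by rewrite lee_fin mulr_ge0 ?sqr_ge0//; exact: (schur_q_ge0 K).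
apply: (@le_trans _ _ (\int[lebesgue_measure]_s ((2 * A)%:E *
    \int[lebesgue_measure]_t (q s t * cmod (f t) ^+ 2)%:E))%E).
  apply: ge0_le_integral => //.
  - by move=> s _; rewrite lee_fin sqr_ge0.
  - apply/measurable_EFinP; apply: measurable_funX; exact: measurable_cmod.
  - exact: measurable_funeM.
  - move=> s _; apply: le_trans (sqr_cmod_cintegral_le _) _.
      exact: cmeasurable_kernel_section (schur_measurable K) mf.
    by rewrite EFinM -muleA lee_wpmul2l// (schur_integral_section s K mf).
rewrite ge0_integralZl//; last by rewrite lee_fin mulr_ge0.
rewrite (EFinM (2 * A)) -muleA lee_wpmul2l ?lee_fin ?mulr_ge0//.
exact: (schur_integral_total K mf).
Qed.

(** The kernel need not be integrable against f at every point, but the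
    function s |-> int q(s, t) |f t|^2 dt has finite integral, hence is finite
    almost everywhere, and it controls the integral of |k(s, t) f t|. *)
Lemma schur_ae_integrable (R : realType) (k : R -> R -> R[i])
    (p q : R -> R -> R) (A B : R) (f : R -> R[i]) :
  schur_kernel k p q A B -> L2 f ->
  {ae lebesgue_measure, forall s,
    (\int[lebesgue_measure]_t (cmod (k s t * f t))%:E < +oo)%E}.
Proof.
move=> K [mf f2]; have [A0 B0] := schur_constants_ge0 K.
pose Q s := (\int[lebesgue_measure]_t (q s t * cmod (f t) ^+ 2)%:E)%E.
have Q0 s : (0 <= Q s)%E.
  apply: integral_ge0 => t _.
  by rewrite lee_fin mulr_ge0 ?sqr_ge0//; exact: (schur_q_ge0 K).
have mQ : measurable_fun setT Q := measurable_schur_integral K mf.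
have iQ : lebesgue_measure.-integrable setT Q.
  apply/integrableP; split=> //.
  under eq_integral do rewrite gee0_abs//.
  apply: le_lt_trans (schur_integral_total K mf) _.
  by apply: lte_mul_pinfty; rewrite ?lee_fin//; exact: L2norm_lty.
have := integrable_ae measurableT iQ.
apply: filterS => s /(_ I) Qs.
have AQ : (A%:E * Q s < +oo)%E by rewrite lte_mul_pinfty// -ge0_fin_numE.
rewrite ltey; apply/eqP => Ioo; have := schur_integral_section s K mf.
by rewrite Ioo expe2 mulyy leye_eq -/(Q s) lt_eqF.
Qed.

(** Equality holds at every point, since changing f on a null set changes no
    section integral. *)
Lemma kernel_op_ae_eq (R : realType) (k : R -> R -> R[i]) (f g : R -> R[i]) :
  measurable_ReIm (fun z : R * R => k z.1 z.2) ->
  cmeasurable f -> cmeasurable g -> f = g %[ae lebesgue_measure] ->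
  kernel_op k f = kernel_op k g.
Proof.
move=> mk mf mg fg; apply/funext => s; rewrite /kernel_op /cintegral.
have [mfr mfi] := cmeasurable_kernel_section s mk mf.
have [mgr mgi] := cmeasurable_kernel_section s mk mg.
congr (_ +i* _)%C; congr fine; apply: ae_eq_integral => //;
  do ?exact/measurable_EFinP.
- by move: fg; apply: filterS => t fgt _; rewrite fgt.
- by move: fg; apply: filterS => t fgt _; rewrite fgt.
Qed.

(** [kernel_op k] is itself a bounded extension of the integral operator to
    the whole of L2: where the defining integral diverges it takes a default
    value, and this happens on a null set only. *)
Lemma schur_test (R : realType) (k : R -> R -> R[i])
    (p q : R -> R -> R) (A B : R) :
  schur_kernel k p q A B -> L2_bounded_operator (kernel_op k).
Proof.
move=> K; have [A0 B0] := schur_constants_ge0 K.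
have mk := schur_measurable K.
split.
- move=> f [mf f2]; split; first exact: cmeasurable_kernel_op.
  apply: lty_L2norm; apply: le_lt_trans (schur_sqr_norm K mf) _.
  apply: lte_mul_pinfty; rewrite ?lee_fin ?mulr_ge0//; exact: L2norm_lty.
- move=> f g [mf _] [mg _] fg; rewrite (kernel_op_ae_eq mk mf mg fg).
  exact: aeW.
- move=> a f g Lf Lg; have := schur_ae_integrable K Lg.
  apply: filterS2 (schur_ae_integrable K Lf) => s fs gs _.
  case: Lf Lg => [mf _] [mg _].
  rewrite /kernel_op -cintegral_linear//; first last.
  + exact: cmeasurable_kernel_section.
  + exact: cmeasurable_kernel_section.
  congr cintegral; apply/funext => t.
  by rewrite mulrDr mulrCA.
- exists (Num.sqrt (2 * A * B)) => f [mf _].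
  have C0 : 0 <= 2 * A * B by rewrite !mulr_ge0.
  rewrite -lee_sqr ?mule_ge0 ?Lnorm_ge0 ?lee_fin ?sqrtr_ge0//.
  rewrite [leRHS]expe2 muleACA -!expe2 -EFin_expe sqr_sqrtr//.
  by rewrite !sqr_L2norm; exact: (schur_sqr_norm K mf).
Qed.

(** * Exponential averages of uniformly locally integrable functions *)

Lemma ge0_integral_sub_setU d (T : measurableType d) (R : realType)
    (mu : {measure set T -> \bar R}) (A B C : set T) (f : T -> \bar R) :
  measurable A -> measurable B -> measurable C ->
  measurable_fun setT f -> (forall x, 0 <= f x)%E -> A `<=` B `|` C ->
  (\int[mu]_(x in A) f x <= \int[mu]_(x in B) f x + \int[mu]_(x in C) f x)%E.
Proof.
move=> mA mB mC mf f0 ABC.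
have mfS D : measurable_fun D f by exact: measurable_funTS.
have mCB : measurable (C `\` B) by exact: measurableD.
apply: (@le_trans _ _ (\int[mu]_(x in B `|` (C `\` B)) f x)%E).
  apply: ge0_subset_integral => //; first exact: measurableU.
  by rewrite setUDr setDv setD0.
rewrite ge0_integral_setU//; last by apply/disj_setPS => x [Bx []].
apply: leeD => //; apply: ge0_subset_integral => //; exact: subDsetl.
Qed.

(** Two adjacent integer cells cover any interval of length 1. *)
Lemma unit_interval_integral_le (R : realType) (w : R -> R) (M : R) :
  measurable_fun setT w -> (forall t, 0 <= w t) ->
  (forall n : int, (\int[lebesgue_measure]_(t in `[n%:~R, (n + 1)%:~R])
     (w t)%:E <= M%:E)%E) ->
  forall a : R,
  (\int[lebesgue_measure]_(t in `[a, (a + 1)%R]) (w t)%:E <= (M + M)%:E)%E.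
Proof.
move=> mw w0 wM a; pose n := Num.floor a.
apply: (@le_trans _ _
  (\int[lebesgue_measure]_(t in `[n%:~R, (n + 1)%:~R]) (w t)%:E +
   \int[lebesgue_measure]_(t in `[(n + 1)%:~R, (n + 1 + 1)%:~R]) (w t)%:E)%E).
  apply: ge0_integral_sub_setU => //; first exact/measurable_EFinP.
  have /andP[na an] := floor_itv a.
  move=> t /=; rewrite !in_itv/= => /andP[at1 ta].
  have [tn|nt] := leP t (n + 1)%:~R; [left|right].
    by rewrite (le_trans na).
  by rewrite (ltW nt)/= (le_trans ta)// rmorphD/= lerD2r ltW.
by rewrite EFinD; apply: leeD.
Qed.

(** The line is cut into the shells S k where |s - t| lies in [k, k + 1).  On
    S k the weight is at most e^-k, and S k is covered by two unit intervals,
    on each of which w has integral at most 2 M; what remains is a geometric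
    series. *)
Lemma exp_weight_bound (R : realType) (w : R -> R) (M : R) :
  measurable_fun setT w -> (forall t, 0 <= w t) ->
  (forall n : int, (\int[lebesgue_measure]_(t in `[n%:~R, (n + 1)%:~R])
     (w t)%:E <= M%:E)%E) ->
  exists C : R, forall s : R,
    (\int[lebesgue_measure]_t (expR (- `|s - t|) * w t)%:E <= C%:E)%E.
Proof.
move=> mw w0 wM; have unit_le := unit_interval_integral_le mw w0 wM.
pose D := (M + M) + (M + M).
have D0 : 0 <= D.
  suff : (0 <= (M + M)%:E)%E by rewrite lee_fin => M0; rewrite addr_ge0.
  apply: le_trans (unit_le 0); apply: integral_ge0 => t _.
  by rewrite lee_fin.
exists (D / (1 - expR (-1))) => s.
pose dist (t : R) : R := `|s - t|.
have mdist : measurable_fun setT dist.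
  by apply: measurableT_comp => //; exact: measurable_funB.
have mew : measurable_fun setT (fun t : R => expR (- `|s - t|) * w t).
  apply: measurable_funM => //; apply: measurableT_comp => //.
  exact: measurable_funN.
have ew0 t : 0 <= expR (- `|s - t|) * w t by rewrite mulr_ge0// expR_ge0.
pose S (k : nat) := [set t : R | k%:R <= `|s - t| < k.+1%:R].
have mS k : measurable (S k).
  rewrite (_ : S k = dist @^-1` `[k%:R, k.+1%:R[).
    by rewrite -[X in measurable X]setTI; apply: mdist.
  by apply/seteqP; split => t /=; rewrite in_itv.
have ST : \bigcup_k S k = setT.
  apply/seteqP; split => // t _.
  exists (Num.trunc `|s - t|) => //=.
  by have := @truncn_itv _ `|s - t| (normr_ge0 _).
have Sdisj : trivIset setT S.
  apply/trivIsetP => i j _ _ ij; apply/seteqP; split => // t [] /= si sj.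
  move: ij; apply/negP; rewrite negbK.
  by rewrite -(@truncn_def _ `|s - t| i)// -(@truncn_def _ `|s - t| j).
rewrite -ST ge0_integral_bigcup//; last 2 first.
  by apply: measurable_funTS; exact/measurable_EFinP.
  by move=> t _; rewrite lee_fin.
have intS k : (\int[lebesgue_measure]_(t in S k)
    (expR (- `|s - t|) * w t)%:E <= (geometric D (expR (-1)) k)%:E)%E.
  apply: (@le_trans _ _ (\int[lebesgue_measure]_(t in S k)
      ((expR (-1) ^+ k)%R%:E * (w t)%:E))%E).
    apply: ge0_le_integral; first exact: mS.
    - by move=> t _; rewrite lee_fin.
    - by apply: measurable_funTS; exact/measurable_EFinP.
    - apply: measurable_funTS; apply: measurable_funeM; exact/measurable_EFinP.
    - move=> t /= /andP[kt _]; rewrite -EFinM lee_fin ler_wpM2r//.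
      by rewrite -expRM_natl ler_expR mulrN1 lerN2.
  rewrite ge0_integralZl//; last 3 first.
    exact: mS.
    by apply: measurable_funTS; exact/measurable_EFinP.
    by move=> t _; rewrite lee_fin.
  rewrite /geometric /= mulrC EFinM; apply: lee_wpmul2l.
    by rewrite lee_fin exprn_ge0// expR_ge0.
  apply: (@le_trans _ _ 
    (\int[lebesgue_measure]_(t in `[(s + k%:R)%R, (s + k%:R + 1)%R])
       (w t)%:E +
     \int[lebesgue_measure]_(t in `[(s - k%:R - 1)%R, (s - k%:R - 1 + 1)%R])
       (w t)%:E)%E).
    apply: ge0_integral_sub_setU => //; first exact: mS.
    - exact/measurable_EFinP.
    move=> t /=; rewrite !in_itv /S /= -natr1.
    by case: (ger0P (s - t)) => st /andP[kt tk]; [right|left]; lra.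
  by rewrite /D EFinD; apply: leeD.
apply: lime_le.
  by apply: is_cvg_nneseries => i _ _; apply: integral_ge0 => t _; rewrite lee_fin.
apply: nearW => n.
apply: (@le_trans _ _ (series (geometric D (expR (-1))) n)%:E).
  by rewrite /series /= -sumEFin; apply: lee_sum => i _; exact: intS.
rewrite lee_fin; apply: geometric_le_lim => //.
by rewrite ger0_norm ?expR_ge0// expR_lt1 oppr_lt0.
Qed.

(** * Sufficiency: both operators pass the Schur test *)

Lemma Kop_plusE (R : realType) (psi f : R -> R[i]) :
  Kop_plus psi f = kernel_op
    (fun s t => if t < s then psi s * ((expR (- (s - t)))%:C)%C else 0) f.
Proof.
apply/funext => s; rewrite /Kop_plus /kernel_op /cintegral.
rewrite Rintegral_mkcond [X in (_ +i* X)%C]Rintegral_mkcond.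
congr (_ +i* _)%C; apply: eq_Rintegral => t _; rewrite patchE.
- case: ifPn; first by rewrite inE /= in_itv/= => ->.
  by rewrite notin_setE /= in_itv/= => /negP/negbTE ->; rewrite mul0r.
- case: ifPn; first by rewrite inE /= in_itv/= => ->.
  by rewrite notin_setE /= in_itv/= => /negP/negbTE ->; rewrite mul0r.
Qed.

(** With w = 1 + |psi|^2, the inequality |psi (max s t)|^2 <= w s * w t holds
    whichever of s and t is the larger.  Splitting the factor exp(-2|s - t|)
    evenly gives Schur weights that are mirror images of each other, so one
    bound C serves for both. *)
Lemma exp_dominated_schur (R : realType) (psi : R -> R[i])
    (k : R -> R -> R[i]) (C : R) :
  cmeasurable psi ->
  (forall s, (\int[lebesgue_measure]_t
    (expR (- `|s - t|) * (1 + cmod (psi t) ^+ 2))%:E <= C%:E)%E) ->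
  measurable_ReIm (fun z : R * R => k z.1 z.2) ->
  (forall s t, cmod (k s t) <= cmod (psi (Num.max s t)) * expR (- `|s - t|)) ->
  schur_kernel k (fun s t => expR (- `|s - t|) * (1 + cmod (psi t) ^+ 2))
                 (fun s t => expR (- `|s - t|) * (1 + cmod (psi s) ^+ 2)) C C.
Proof.
move=> [mr mi] intC mk kpsi.
have mw : measurable_fun setT (fun t : R => 1 + cmod (psi t) ^+ 2).
  by apply: measurable_funD => //; apply: measurable_funX; exact: measurable_cmod.
have me : measurable_fun setT (fun z : R * R => expR (- `|z.1 - z.2|)).
  apply: measurableT_comp => //; apply: measurable_funN.
  by apply: measurableT_comp => //; apply: measurable_funB.
have w0 t : 0 <= 1 + cmod (psi t) ^+ 2 by rewrite addr_ge0// sqr_ge0.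
split => //.
- by apply: measurable_funM => //; exact: (measurableT_comp mw measurable_snd).
- by apply: measurable_funM => //; exact: (measurableT_comp mw measurable_fst).
- by move=> s t; rewrite mulr_ge0// expR_ge0.
- by move=> s t; rewrite mulr_ge0// expR_ge0.
- move=> s t; rewrite mulrACA -expr2 mulrC.
  apply: (@le_trans _ _ ((cmod (psi (Num.max s t)) * expR (- `|s - t|)) ^+ 2)).
    by rewrite ler_pXn2r// nnegrE ?mulr_ge0 ?cmod_ge0 ?expR_ge0.
  rewrite exprMn ler_wpM2r ?sqr_ge0//.
  have := sqr_ge0 (cmod (psi s)); have := sqr_ge0 (cmod (psi t)).
  by case: (leP s t) => _; nra.
- by move=> t; under eq_integral do rewrite distrC; exact: intC.
Qed.

Lemma measurable_ReIm_exp (R : realType) :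
  measurable_ReIm (fun z : R * R => ((expR (- `|z.1 - z.2|))%:C)%C).
Proof.
split => /=; last exact: measurable_cst.
apply: measurableT_comp => //; apply: measurable_funN.
by apply: measurableT_comp => //; apply: measurable_funB.
Qed.

Lemma Kop_bounded (R : realType) (psi : R -> R[i]) (C : R) :
  cmeasurable psi ->
  (forall s, (\int[lebesgue_measure]_t
    (expR (- `|s - t|) * (1 + cmod (psi t) ^+ 2))%:E <= C%:E)%E) ->
  L2_bounded_operator (Kop psi).
Proof.
move=> mpsi intC.
pose k s t := psi (Num.max s t) * ((expR (- `|s - t|))%:C)%C.
apply: (schur_test (k := k) (exp_dominated_schur mpsi intC _ _)).
- apply: measurable_ReImM (measurable_ReIm_exp R).
  apply: (measurable_ReIm_comp mpsi); apply: measurable_maxr.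
    exact: measurable_fst.
  exact: measurable_snd.
- by move=> s t; rewrite cmodM cmod_real ger0_norm ?expR_ge0.
Qed.

Lemma Kop_plus_bounded (R : realType) (psi : R -> R[i]) (C : R) :
  cmeasurable psi ->
  (forall s, (\int[lebesgue_measure]_t
    (expR (- `|s - t|) * (1 + cmod (psi t) ^+ 2))%:E <= C%:E)%E) ->
  L2_bounded_operator (Kop_plus psi).
Proof.
move=> mpsi intC.
pose k s t := if t < s then psi s * ((expR (- (s - t)))%:C)%C else 0.
rewrite (_ : Kop_plus psi = kernel_op k); last first.
  by apply/funext => f; exact: Kop_plusE.
apply: (schur_test (exp_dominated_schur mpsi intC _ _)).
- have -> : (fun z : R * R => k z.1 z.2) = (fun z : R * R =>
      ((if z.2 < z.1 then 1 else 0 : R)%:C)%C *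
      (psi z.1 * ((expR (- `|z.1 - z.2|))%:C)%C)).
    apply/funext => -[s t] /=; rewrite /k; case: ifPn => [ts|_].
      by rewrite mul1r ger0_norm// subr_ge0 ltW.
    by rewrite mul0r.
  apply: measurable_ReImM; last first.
    apply: measurable_ReImM (measurable_ReIm_exp R).
    exact: (measurable_ReIm_comp mpsi measurable_fst).
  split => /=; last exact: measurable_cst.
  apply: measurable_fun_ifT => //; apply: measurable_fun_ltr.
    exact: measurable_snd.
  exact: measurable_fst.
- move=> s t; rewrite /k; case: ifPn => [ts|_].
    rewrite cmodM cmod_real ger0_norm ?expR_ge0//.
    by rewrite max_l ?(ltW ts)// ger0_norm// subr_ge0 ltW.
  rewrite (_ : cmod 0 = 0) ?mulr_ge0 ?cmod_ge0 ?expR_ge0//.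
  exact: ComplexField.Normc.normc0.
Qed.

(** * Necessity: testing on indicators of unit intervals *)

Definition unit_indic (R : realType) (a : R) (t : R) : R[i] :=
  ((\1_(`[a - 1, a]%classic : set R) t)%:C)%C.

Lemma lebesgue_unit_itv (R : realType) (a : R) :
  (@lebesgue_measure R `[(a - 1)%R, a]%classic = 1)%E.
Proof.
rewrite lebesgue_measure_itv/= lte_fin gtrBl ltr01 -EFinB.
by rewrite opprB addrC subrK.
Qed.

Lemma cmod_unit_indic (R : realType) (a t : R) :
  cmod (unit_indic a t) = \1_(`[a - 1, a]%classic : set R) t.
Proof. by rewrite /unit_indic cmod_real ger0_norm. Qed.

Lemma bounded_compactly_supported_unit_indic (R : realType) (a : R) :
  bounded_compactly_supported (unit_indic a).
Proof.
split.
- by split => /=; [exact: measurable_indic|exact: measurable_cst].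
- exists 1 => t; rewrite cmod_unit_indic indicE.
  by case: (_ \in _).
- rewrite (_ : [set t | _] = `[a - 1, a]%classic); last first.
    apply/seteqP; split => t /=; rewrite /unit_indic indicE.
      by case: (boolP (t \in _)) => [|_]; [rewrite inE|rewrite eqxx].
    by move=> ta; rewrite mem_set// oner_neq0.
  rewrite -(closure_id _).1; first exact: segment_compact.
  exact: itv_closed.
Qed.

Lemma sqr_L2norm_unit_indic (R : realType) (a : R) :
  (L2norm (unit_indic a) ^+ 2 = 1)%E.
Proof.
rewrite sqr_L2norm -[RHS](lebesgue_unit_itv a) -[in RHS](setIT `[_, _]%classic).
rewrite -integral_indic//; apply: eq_integral => t _.
by rewrite cmod_unit_indic indicE; case: (_ \in _); rewrite ?expr1n ?expr0n.
Qed.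

Lemma L2_unit_indic (R : realType) (a : R) : L2 (unit_indic a).
Proof.
split; first by case: (bounded_compactly_supported_unit_indic a).
by apply: lty_L2norm; rewrite -sqr_L2norm sqr_L2norm_unit_indic ltry.
Qed.

(** To the right of the support of the test function the kernel factors: the
    image at s is psi(s) times the integral of e^-(s - t) over [a - 1, a],
    where s - t < 2. *)
Lemma kernel_op_unit_indic_ge (R : realType) (psi : R -> R[i]) (k : R -> R -> R[i])
    (a s : R) :
  (forall t, t < s -> k s t = psi s * ((expR (- (s - t)))%:C)%C) ->
  a < s < a + 1 ->
  expR (- 2) * cmod (psi s) <= cmod (kernel_op k (unit_indic a) s).
Proof.
move=> ks /andP[as_ sa].
pose h t := expR (- (s - t)) * \1_(`[a - 1, a]%classic : set R) t.
have mh : measurable_fun setT h.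
  apply: measurable_funM; last exact: measurable_indic.
  apply: measurableT_comp => //; apply: measurable_funN.
  exact: measurable_funB.
have h0 t : 0 <= h t by rewrite mulr_ge0 ?expR_ge0.
have hle t : h t <= \1_(`[a - 1, a]%classic : set R) t.
  rewrite /h indicE; case: (boolP (t \in _)) => [|_]; last by rewrite mulr0.
  rewrite inE/= in_itv/= => /andP[_ ta]; rewrite mulr1 -expR0 ler_expR.
  by lra.
have hge t : expR (- 2) * \1_(`[a - 1, a]%classic : set R) t <= h t.
  rewrite /h indicE; case: (boolP (t \in _)) => [|_]; last by rewrite !mulr0.
  rewrite inE/= in_itv/= => /andP[at_ ta]; rewrite !mulr1 ler_expR.
  by lra.
have mind : measurable_fun setT
    (fun t => (\1_(`[a - 1, a]%classic : set R) t)%:E : \bar R).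
  by apply/measurable_EFinP; exact: measurable_indic.
have ind1 : (\int[lebesgue_measure]_t
    (\1_(`[a - 1, a]%classic : set R) t)%:E = 1 :> \bar R)%E.
  by rewrite integral_indic// setIT; exact: lebesgue_unit_itv.
have inth_le : (\int[lebesgue_measure]_t (h t)%:E <= 1)%E.
  rewrite -ind1; apply: ge0_le_integral => //.
  - by move=> t _; rewrite lee_fin.
  - exact/measurable_EFinP.
  - by move=> t _; rewrite lee_fin.
have inth_ge : ((expR (- 2))%:E <= \int[lebesgue_measure]_t (h t)%:E)%E.
  rewrite -[leLHS]mule1 -ind1 -ge0_integralZl//.
  apply: ge0_le_integral => //.
  - exact: measurable_funeM.
  - exact/measurable_EFinP.
  - by move=> t _; rewrite -EFinM lee_fin.
(* The summand 0 puts the integrand in the shape of cintegral_linear. *)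
have -> : kernel_op k (unit_indic a) s =
    cintegral setT (fun t => psi s * ((h t)%:C)%C + 0).
  rewrite /kernel_op; congr cintegral; apply/funext => t.
  rewrite /unit_indic /h indicE addr0; case: (boolP (t \in _)) => [|_].
    rewrite inE/= in_itv/= => /andP[_ ta].
    by rewrite ks ?(le_lt_trans ta)// !mulr1.
  by rewrite !mulr0.
rewrite cintegral_linear; first last.
- rewrite integral0_eq ?ltry// => t _.
  by rewrite /cmod ComplexField.Normc.normc0.
- apply: le_lt_trans (ltry 1); apply: le_trans inth_le.
  by under eq_integral do rewrite cmod_real ger0_norm//.
- by split; exact: measurable_cst.
- by split => //=; exact: measurable_cst.
rewrite (_ : cintegral setT (fun=> 0) = 0) ?addr0; last first.
  by rewrite /cintegral /Rintegral !integral0.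
rewrite (_ : cintegral setT _ = ((Rintegral lebesgue_measure setT h)%:C)%C).
  rewrite cmodM cmod_real mulrC ler_wpM2l ?cmod_ge0//.
  apply: le_trans (ler_norm _); rewrite /Rintegral.
  by rewrite -lee_fin fineK// ge0_fin_numE ?(le_lt_trans inth_le) ?ltry//
    (le_trans _ inth_ge)// lee_fin expR_ge0.
by rewrite /cintegral /= {2}/Rintegral integral0.
Qed.

(** The extension T only agrees with K almost everywhere, hence the integral
    comparison below is an almost everywhere one; the test functions all have
    norm 1, which makes the resulting bound independent of a. *)
Lemma unit_integral_le_of_bounded (R : realType) (psi : R -> R[i])
    (K : (R -> R[i]) -> (R -> R[i])) :
  cmeasurable psi -> bounded_on_L2 K ->
  (forall a s, a < s < a + 1 ->
    expR (- 2) * cmod (psi s) <= cmod (K (unit_indic a) s)) ->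
  exists C : R, forall a : R,
    (\int[lebesgue_measure]_(x in `[a, (a + 1)%R]) (cmod (psi x) ^+ 2)%:E <=
     C%:E)%E.
Proof.
move=> [mr mi] [T [[T2 _ _ [C TC]] TK]] Kge.
exists (expR 2 ^+ 2 * C ^+ 2) => a.
have mpsi2 : measurable_fun setT (fun x => (cmod (psi x) ^+ 2)%:E).
  by apply/measurable_EFinP; apply: measurable_funX; exact: measurable_cmod.
have [[mTr mTi] _] := T2 _ (L2_unit_indic a).
have mT2 : measurable_fun setT (fun x => (cmod (T (unit_indic a) x) ^+ 2)%:E).
  by apply/measurable_EFinP; apply: measurable_funX; exact: measurable_cmod.
rewrite integral_itv_bndoo; last exact: measurable_funTS.
apply: (@le_trans _ _ (\int[lebesgue_measure]_(x in `]a, (a + 1)%R[)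
    ((expR 2 ^+ 2)%R%:E * (cmod (T (unit_indic a) x) ^+ 2)%:E))%E).
  apply: ae_ge0_le_integral => //.
  - by move=> x _; rewrite lee_fin sqr_ge0.
  - exact: measurable_funTS.
  - by move=> x _; rewrite -EFinM lee_fin mulr_ge0// sqr_ge0.
  - by apply: measurable_funTS; exact: measurable_funeM.
  - have := TK _ (bounded_compactly_supported_unit_indic a).
    apply: filterS => x /(_ I) Tx; rewrite /= in_itv/= => xa.
    rewrite -EFinM lee_fin -exprMn ler_pXn2r ?nnegrE ?mulr_ge0 ?expR_ge0 ?cmod_ge0//.
    by rewrite -ler_pdivrMl ?expR_gt0// -expRN Tx Kge.
apply: (@le_trans _ _ (\int[lebesgue_measure]_x
    ((expR 2 ^+ 2)%R%:E * (cmod (T (unit_indic a) x) ^+ 2)%:E))%E).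
  apply: ge0_subset_integral => //; first exact: measurable_funeM.
  by move=> x _; rewrite -EFinM lee_fin mulr_ge0// sqr_ge0.
rewrite ge0_integralZl//; last first.
  by move=> x _; rewrite lee_fin sqr_ge0.
rewrite (EFinM (expR 2 ^+ 2)) lee_wpmul2l ?lee_fin ?sqr_ge0// -sqr_L2norm.
have Tle := TC _ (L2_unit_indic a).
apply: (@le_trans _ _ ((C%:E * L2norm (unit_indic a)) ^+ 2)%E).
  by rewrite lee_sqr ?Lnorm_ge0// (le_trans _ Tle)// Lnorm_ge0.
by rewrite expe2 muleACA -!expe2 sqr_L2norm_unit_indic mule1 EFin_expe.
Qed.

(** * The characterization *)

Lemma bounded_on_L2_of_operator (R : realType)
    (K : (R -> R[i]) -> (R -> R[i])) :
  L2_bounded_operator K -> bounded_on_L2 K.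
Proof. by move=> bK; exists K; split => // f _; exact: aeW. Qed.

Lemma sup_lty_of_bounded (R : realType) (psi : R -> R[i])
    (K : (R -> R[i]) -> (R -> R[i])) :
  cmeasurable psi -> bounded_on_L2 K ->
  (forall a s, a < s < a + 1 ->
    expR (- 2) * cmod (psi s) <= cmod (K (unit_indic a) s)) ->
  (ereal_sup [set (\int[lebesgue_measure]_(x in `[n%:~R, (n + 1)%:~R])
     (cmod (psi x) ^+ 2)%:E)%E | n in [set: int]] < +oo)%E.
Proof.
move=> mpsi bK Kge; have [C HC] := unit_integral_le_of_bounded mpsi bK Kge.
apply: le_lt_trans (ltry C); apply: ge_ereal_sup => _ [n _ <-].
by rewrite rmorphD/=; exact: HC.
Qed.

Lemma exp_weight_bound_of_sup (R : realType) (psi : R -> R[i]) :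
  cmeasurable psi ->
  (ereal_sup [set (\int[lebesgue_measure]_(x in `[n%:~R, (n + 1)%:~R])
     (cmod (psi x) ^+ 2)%:E)%E | n in [set: int]] < +oo)%E ->
  exists C : R, forall s, (\int[lebesgue_measure]_t
    (expR (- `|s - t|) * (1 + cmod (psi t) ^+ 2))%:E <= C%:E)%E.
Proof.
move=> [mr mi] supoo.
have mpsi2 : measurable_fun setT (fun t => cmod (psi t) ^+ 2).
  by apply: measurable_funX; exact: measurable_cmod.
have [M supM] : exists M : R, (ereal_sup
    [set (\int[lebesgue_measure]_(x in `[n%:~R, (n + 1)%:~R])
     (cmod (psi x) ^+ 2)%:E)%E | n in [set: int]] <= M%:E)%E.
  by case: (ereal_sup _) supoo => [r| |]// _; [exists r|exists 0; rewrite leNye].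
apply: (@exp_weight_bound _ _ (1 + M)).
- exact: measurable_funD.
- by move=> t; rewrite addr_ge0// sqr_ge0.
- move=> n; under eq_integral do rewrite EFinD.
  rewrite ge0_integralD//; first last.
  + by apply/measurable_EFinP; exact: measurable_funTS.
  + by move=> t _; rewrite lee_fin sqr_ge0.
  rewrite EFinD; apply: leeD.
    rewrite integral_cst//= mul1e lebesgue_measure_itv/= lte_fin ltr_int ltrDl.
    by rewrite -EFinB -rmorphB/= addrAC subrr add0r.
  by apply: le_trans supM; apply: ereal_sup_ubound; exists n.
Qed.

Theorem theorem13p2 (R : realType) (psi : R -> R[i]) (hpsi : L2loc psi) :
  (bounded_on_L2 (Kop psi) <-> bounded_on_L2 (Kop_plus psi)) /\
  (bounded_on_L2 (Kop_plus psi) <->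
    (ereal_sup [set (\int[lebesgue_measure]_(x in `[n%:~R, (n + 1)%:~R])
                       (cmod (psi x) ^+ 2)%:E)%E | n in [set: int]] < +oo)%E).
Proof.
have [mpsi _] := hpsi.
have Kge a s : a < s < a + 1 ->
    expR (- 2) * cmod (psi s) <= cmod (Kop psi (unit_indic a) s).
  pose k s t := psi (Num.max s t) * ((expR (- `|s - t|))%:C)%C.
  apply: (kernel_op_unit_indic_ge (k := k)) => t ts.
  by rewrite /k max_l ?(ltW ts)// ger0_norm// subr_ge0 ltW.
have Kplusge a s : a < s < a + 1 ->
    expR (- 2) * cmod (psi s) <= cmod (Kop_plus psi (unit_indic a) s).
  by rewrite Kop_plusE; apply: kernel_op_unit_indic_ge => t ts; rewrite ts.
split; split => bK.
- have [C intC] := exp_weight_bound_of_sup mpsi (sup_lty_of_bounded mpsi bK Kge).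
  exact/bounded_on_L2_of_operator/(Kop_plus_bounded mpsi intC).
- have [C intC] :=
    exp_weight_bound_of_sup mpsi (sup_lty_of_bounded mpsi bK Kplusge).
  exact/bounded_on_L2_of_operator/(Kop_bounded mpsi intC).
- exact: sup_lty_of_bounded mpsi bK Kplusge.
- have [C intC] := exp_weight_bound_of_sup mpsi bK.
  exact/bounded_on_L2_of_operator/(Kop_plus_bounded mpsi intC).
Qed.
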